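(* Let $c$ be a configuration of the complete graph $K_n$ with $c(v)\le n-1$ for all vertices $v$. Then $c$ is volatile if and only if there is an ordering $v_1,v_2,\dots,v_n$ of $V(K_n)$ such that $c(v_i)\ge n-i$ for all $i\in\{1,\dots,n\}$.
   Context: A configuration of a graph $G$ is a function $c: V(G)\to \mathbb{N}\cup\{0\}$. A vertex $v$ may be fired if it currently has at least $\deg(v)$ chips; firing $v$ removes $\deg(v)$ chips from $v$ and adds one chip to each neighbour. A configuration is volatile if there is an infinite sequence of vertices that may be fired in that order. *)

(* Defs.v *)
From mathcomp Require Import all_boot.

Set Implicit Arguments.
Unset Strict Implicit.
Unset Printing Implicit Defensive.

Record sgraph := SGraph {
  vertex :> finType;
  adj : rel vertex;
  adj_sym : symmetric adj;
  adj_irrefl : irreflexive adj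
}.

Definition deg (G : sgraph) (v : G) : nat := #|[set u : G | adj v u]|.

Definition configuration (G : sgraph) := {ffun G -> nat}.

Definition can_fire (G : sgraph) (c : configuration G) (v : G) : bool :=
  deg v <= c v.

(* The subtraction is truncated, so this is the intended move only when
   [can_fire c v] holds; [volatile] requires that at every step. *)
Definition fire (G : sgraph) (c : configuration G) (v : G) : configuration G :=
  [ffun u => if u == v then c u - deg v else c u + adj v u].

Fixpoint config_after (G : sgraph) (c : configuration G) (s : nat -> G)
    (k : nat) : configuration G :=
  if k is k'.+1 then fire (config_after c s k') (s k') else c.

Definition volatile (G : sgraph) (c : configuration G) : Prop :=
  exists s : nat -> G, forall k : nat, can_fire (config_after c s k) (s k).

Lemma neq_sym (T : eqType) : symmetric (fun u v : T => u != v).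
Proof. by move=> u v; rewrite eq_sym. Qed.

Lemma neq_irrefl (T : eqType) : irreflexive (fun u v : T => u != v).
Proof. by move=> u; rewrite eqxx. Qed.

Definition complete_graph (n : nat) : sgraph :=
  SGraph (@neq_sym 'I_n) (@neq_irrefl 'I_n).

(* Main.v *)
(** In [K_n] every firing adds one chip to each vertex, and then takes [n] chips
    from the fired one; so after [k] firings, [u] holds
    [c u + k - n * (number of firings of u)] chips.  If no vertex starts with
    more than [n - 1] chips, then a vertex already fired cannot be fired again
    within the first [n] steps; hence the first [n] firings of a legal infinite
    sequence form the required ordering.  Conversely, such an ordering can be
    fired cyclically forever: firing its first vertex and moving it to the end
    yields an ordering of the same kind for the new configuration. *)

Require Import Defs.
From mathcomp Require Import all_boot zify.

Lemma deg_complete_graph (n : nat) (v : complete_graph n) : deg v = n.-1.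
Proof.
rewrite /deg -[in RHS](card_ord n) -(cardsC1 v).
by apply: eq_card => u; rewrite !inE eq_sym.
Qed.

(** The firings are counted on the left to avoid truncated subtraction; legality makes the
    subtraction in [fire] exact. *)
Lemma config_after_complete_graph (n : nat) (c : configuration (complete_graph n))
    (s : nat -> complete_graph n) (k : nat) (u : complete_graph n) :
  (forall j, j < k -> can_fire (config_after c s j) (s j)) ->
  config_after c s k u + n * (\sum_(j < k) (s j == u)) = c u + k.
Proof.
elim: k => [|k IHk] legal; first by rewrite big_ord0 muln0.
have {}IHk := IHk (fun j ltjk => legal j (ltnW ltjk)).
have := legal k (leqnn _); rewrite /can_fire deg_complete_graph => fire_k.
have -> : \sum_(j < k.+1) (s j == u) = \sum_(j < k) (s j == u) + (s k == u).
  by rewrite big_ord_recr.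
rewrite [config_after _ _ _.+1]/(fire (config_after c s k) (s k)).
rewrite ffunE deg_complete_graph [adj _ _]/(s k != u) mulnDr.
have n_gt0 : 0 < n by case: (u) => i /=; apply: leq_ltn_trans.
by case: (eqVneq u (s k)) IHk => [->|_]; lia.
Qed.

Lemma volatile_initial_inj (n : nat) (c : configuration (complete_graph n))
    (s : nat -> complete_graph n) :
  (forall v, c v <= n - 1) ->
  (forall k, can_fire (config_after c s k) (s k)) ->
  forall j k, j < k < n -> s j != s k.
Proof.
move=> hc legal j k /andP[ltjk ltkn]; apply/eqP => eq_s.
have fired : 0 < \sum_(i < k) (s i == s k).
  by rewrite (bigD1 (Ordinal ltjk)) //= eq_s eqxx.
(* Firing [s k] again would need [n - 1 + n <= c (s k) + k], but [c (s k) <= n - 1] and [k < n]. *)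
have := @config_after_complete_graph n c s k (s k) (fun i _ => legal i).
have := legal k; rewrite /can_fire deg_complete_graph.
have := hc (s k); nia.
Qed.

Lemma cyclic_config_ge (n : nat) (c : configuration (complete_graph n))
    (v : nat -> complete_graph n) :
  (forall i j, i < n -> j < n -> v i = v j -> i = j) ->
  (forall i, i < n -> n - i.+1 <= c (v i)) ->
  forall k i, i < n ->
    n - i.+1 <= config_after c (fun j => v (j %% n)) k (v ((k + i) %% n)).
Proof.
move=> v_inj hv; elim=> [|k IHk] i ltin; first by rewrite modn_small ?hv.
(* The vertex just fired is now last, where the bound is 0; any other vertex moves up one place and
   gains a chip. *)
have [->|i_last] := eqVneq i.+1 n; first by rewrite subnn.
have lt_i1n : i.+1 < n by lia.
have := IHk _ lt_i1n; rewrite addSnnS.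
rewrite [config_after _ _ k.+1]/(fire (config_after c _ k) (v (k %% n))) ffunE.
rewrite [adj _ _]/(v (k %% n) != v ((k + i.+1) %% n)) eq_sym.
have -> : (v (k %% n) == v ((k + i.+1) %% n)) = false.
  apply/eqP => /esym/v_inj /=; rewrite !ltn_mod => /(_ _ _)/eqP.
  rewrite -{2}[k]addn0 eqn_modDl mod0n modn_small //.
  by case: n ltin {v_inj hv IHk i_last lt_i1n c v} => // n _ /(_ isT isT).
by lia.
Qed.

Theorem theorem2p3 (n : nat) (hn : 0 < n)
    (c : configuration (complete_graph n))
    (hc : forall v : complete_graph n, c v <= n - 1) :
  volatile c <->
  exists v : 'I_n -> complete_graph n,
    bijective v /\ forall i : 'I_n, n - i.+1 <= c (v i).
Proof.
split=> [[s legal]|[v [v_bij hv]]].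
  have s_neq := @volatile_initial_inj n c s hc legal.
  exists (fun i : 'I_n => s i); split=> [|i].
    apply: injF_bij => i j eq_s; apply: val_inj => /=.
    case: (ltngtP i j) => // lt.
      by have := s_neq i j; rewrite lt ltn_ord eq_s eqxx => /(_ isT).
    by have := s_neq j i; rewrite lt ltn_ord eq_s eqxx => /(_ isT).
  (* At most [i] chips were gained before this firing, so [n - 1 <= c (s i) + i]. *)
  have := @config_after_complete_graph n c s i (s i) (fun j _ => legal j).
  have := legal i; rewrite /can_fire deg_complete_graph; lia.
case: n hn c hc v v_bij hv => // n _ c _ v /bij_inj v_inj hv.
pose w (i : nat) := v (inord i).
have w_inj i j : i < n.+1 -> j < n.+1 -> w i = w j -> i = j.
  by move=> lti ltj /v_inj /(congr1 val); rewrite /= !inordK.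
have hw i : i < n.+1 -> n.+1 - i.+1 <= c (w i).
  by move=> lti; have := hv (inord i); rewrite inordK.
exists (fun k => w (k %% n.+1)) => k.
(* At position 0 the bound is [n], the degree in the graph on [n.+1] vertices. *)
have := @cyclic_config_ge n.+1 c w w_inj hw k 0 (ltn0Sn n).
by rewrite addn0 subn1 /can_fire deg_complete_graph.
Qed.
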